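(* Let $0<\lambda<1$ and let $(X,S,\mathcal B,\mu)$ denote the nonsingular type $\mathrm{III}_\lambda$ HK$(+1,\lambda)$ transformation. Then there does not exist a nontrivial Borel equivariant map $\phi:(X,S,\mathcal B,\mu)\to(Y,T,d)$ where $T$ is an isometry on a separable metric space $(Y,d)$. That is, whenever $(Y,d)$ is a separable metric space, $T:Y\to Y$ is an isometry, and $\phi:X\to Y$ is a Borel map with $T\circ\phi=\phi\circ S$ $\mu$-a.e., the map $\phi$ is constant $\mu$-a.e.
   Context: The nonsingular HK$(+1,\lambda)$ transformation $(X,S,\mathcal B,\mu)$ is constructed by cutting and stacking. A column is a finite ordered collection $C_k=\{C_k(0),\dots,C_k(h_k-1)\}$ of pairwise disjoint intervals (levels); $h_k$ is its height. Start with $C_0=\{[0,1)\}$, $h_0=1$. Given $C_k$, cut each level $C_k(i)$ into a left subinterval $C_k(i)^{\mathrm{left}}$ and a right subinterval $C_k(i)^{\mathrm{right}}$ whose lengths satisfy $|C_k(i)^{\mathrm{right}}|=\lambda\,|C_k(i)^{\mathrm{left}}|$. Stack the right subcolumn on top of the left subcolumn, and put $2h_k+1$ new disjoint intervals (spacers) of positive finite length on top; that is, $C_{k+1}(i)=C_k(i)^{\mathrm{left}}$ for $0\le i<h_k$, $C_{k+1}(i)=C_k(i-h_k)^{\mathrm{right}}$ for $h_k\le i<2h_k$, and $C_{k+1}(i)$ is a new spacer interval for $2h_k\le i<4h_k+1$; so $h_{k+1}=4h_k+1$. The maximum length of the levels of $C_k$ tends to $0$ as $k\to\infty$. The space $X$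 is the union of all levels of all columns, $\mathcal B$ its Borel sets, $\mu$ is Lebesgue measure, and $S$ is the a.e. defined invertible map sending each level $C_k(i)$, $0\le i<h_k-1$, to $C_k(i+1)$ by the orientation-preserving affine bijection (these maps are consistent as $k$ grows). ''Nontrivial'' for an equivariant map means not constant $\mu$-a.e. *)

(* Defs.v *)
From HB Require Import structures.
From mathcomp Require Import all_boot all_order all_algebra.
From mathcomp Require Import all_classical all_reals all_analysis.

Set Implicit Arguments.
Unset Strict Implicit.
Unset Printing Implicit Defensive.

Import Order.TTheory GRing.Theory Num.Theory.
Import numFieldNormedType.Exports.

Local Open Scope classical_set_scope.
Local Open Scope ring_scope.

(* A pair (a, l) encodes the interval [a, a + l[ of length l.  Half-open
   intervals are used throughout, so that cutting a level partitions it. *)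
Definition ival {R : realType} (I : R * R) : set R := `[I.1, I.1 + I.2[%classic.

(* The cut is in the proportions 1 : lambda, so the left part has length
   l / (1 + lambda) and the right part lambda * l / (1 + lambda). *)
Definition cut_left {R : realType} (lambda : R) (I : R * R) : R * R :=
  (I.1, I.2 / (1 + lambda)).

Definition cut_right {R : realType} (lambda : R) (I : R * R) : R * R :=
  (I.1 + I.2 / (1 + lambda), lambda * (I.2 / (1 + lambda))).

Fixpoint HK_height (k : nat) : nat :=
  if k is k'.+1 then (4 * HK_height k' + 1)%N else 1%N.

(* The spacers added to C_k are [sp k j] for j < 2 * h_k + 1; the level C_k(i)
   is [HK_level lambda sp k i] for i < h_k.  Out of these ranges the values of
   [sp] and [HK_level] are irrelevant. *)
Fixpoint HK_level {R : realType} (lambda : R) (sp : nat -> nat -> R * R)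
    (k i : nat) : R * R :=
  if k is k'.+1 then
    let h := HK_height k' in
    if (i < h)%N then cut_left lambda (HK_level lambda sp k' i)
    else if (i < 2 * h)%N then cut_right lambda (HK_level lambda sp k' (i - h)%N)
    else sp k' (i - 2 * h)%N
  else (0, 1).

(* Disjointness of the levels within every single column C_k already forces
   new spacers to avoid all the earlier levels. *)
Definition HK_spacers {R : realType} (lambda : R) (sp : nat -> nat -> R * R)
    : Prop :=
  [/\ forall k j, (j < 2 * HK_height k + 1)%N -> 0 < (sp k j).2,
      forall k, trivIset `I_(HK_height k) (ival \o HK_level lambda sp k) &
      (fun k => \big[Num.max/0]_(i < HK_height k) (HK_level lambda sp k i).2)
        @ \oo --> (0 : R)].

Definition HK_space {R : realType} (lambda : R) (sp : nat -> nat -> R * R)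
    : set R :=
  \bigcup_k \bigcup_(i in `I_(HK_height k)) ival (HK_level lambda sp k i).

Definition affine_ival {R : realType} (I J : R * R) (x : R) : R :=
  J.1 + (x - I.1) / I.2 * J.2.

(* The graph of S is the union of the graphs of the affine bijections
   C_k(i) -> C_k(i+1), i + 1 < h_k.  The top level of C_(k+1) is a new spacer,
   so every point of C_k lies below it and the domain is all of X; outside X,
   S is the identity. *)
Definition HK_map {R : realType} (lambda : R) (sp : nat -> nat -> R * R)
    (x : R) : R :=
  xget x [set y | exists k i, [/\ (i.+1 < HK_height k)%N,
    ival (HK_level lambda sp k i) x &
    y = affine_ival (HK_level lambda sp k i) (HK_level lambda sp k i.+1) x]].

Definition separable_space (Y : topologicalType) : Prop :=
  exists D : set Y, countable D /\ dense D.

Definition metric_isometry {R : realType} (Y : metricType R) (T : Y -> Y)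
    : Prop :=
  forall x y, mdist (T x) (T y) = mdist x y.

(* The library's g_sigma_algebraType is limited to pointed types, whence the
   explicit Borel sigma-algebra <<s open >> of Y instead of measurable_fun. *)
Definition borel_on {R : realType} (X : set R) (Y : topologicalType)
    (phi : R -> Y) : Prop :=
  forall B : set Y, <<s @open Y >> B ->
    measurable (X `&` phi @^-1` B : set (measurableTypeR R)).

(* Main.v *)
Require Import Defs.
From HB Require Import structures.
From mathcomp Require Import all_boot all_order all_algebra.
From mathcomp Require Import all_classical all_reals all_analysis.
From mathcomp Require Import measurable_realfun ring lra zify.

Import Order.TTheory GRing.Theory Num.Theory.
Import numFieldNormedType.Exports.

Local Open Scope classical_set_scope.
Local Open Scope ring_scope.

(* Write h_k for the height of C_k.  If phi maps most of a level C_k(i) into a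
   ball B of radius e, then, S^(h_k) mapping the left part of C_k(i) to its
   right part, some y in B has T^(h_k) y in B; applied to the left part, which
   is a level of C_(k+1), the remark gives y in B with T^(4 h_k + 1) y in B.
   As T is an isometry, T^(h_k) and T^(4 h_k + 1) both move all points of B by
   O(e), hence so does T.  Lebesgue density provides such levels, whence
   T (phi x) = phi x for almost every x, that is, phi is S-invariant.
   Now S is ergodic: an invariant set and its complement, if both had positive
   measure, would each fill more than half of some level of a common column,
   but the levels of a column are mapped to each other affinely by powers of S.
   Hence phi^-1(B) is null or conull for every ball B, and phi is constant by
   separability. *)

(** * Intervals, their cuts and the affine bijections between them *)

Section intervals.
Context {R : realType}.
Implicit Types (I J K : R * R) (x lambda : R).

Lemma ivalE I x : ival I x = (I.1 <= x < I.1 + I.2) :> Prop.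
Proof. by rewrite /ival /= in_itv. Qed.

Lemma affine_ival_id I x : 0 < I.2 -> affine_ival I I x = x.
Proof. by move=> /gt_eqF I0; rewrite /affine_ival; field; rewrite I0. Qed.

Lemma affine_ival_comp I J K x : 0 < J.2 ->
  affine_ival J K (affine_ival I J x) = affine_ival I K x.
Proof.
move=> /gt_eqF J0; rewrite /affine_ival [J.1 + _]addrC addrK.
by rewrite mulfK// J0.
Qed.

Lemma affine_ivalP I J x : 0 < I.2 -> 0 < J.2 ->
  ival J (affine_ival I J x) <-> ival I x.
Proof.
move=> I0 J0; rewrite !ivalE /affine_ival lerDl ltrD2l.
rewrite pmulr_lge0// pmulr_lge0 ?invr_gt0// subr_ge0.
by rewrite gtr_pMl// ltr_pdivrMr// mul1r ltrBlDl.
Qed.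

Lemma affine_ival_linear I J x :
  affine_ival I J x = J.2 / I.2 * x + (J.1 - J.2 / I.2 * I.1).
Proof. by rewrite /affine_ival; ring. Qed.

Lemma cut_left_gt0 lambda I : 0 < lambda -> 0 < I.2 ->
  0 < (cut_left lambda I).2.
Proof. by move=> l0 I0; rewrite divr_gt0// addr_gt0. Qed.

Lemma cut_right_gt0 lambda I : 0 < lambda -> 0 < I.2 ->
  0 < (cut_right lambda I).2.
Proof. by move=> l0 I0; rewrite mulr_gt0// divr_gt0// addr_gt0. Qed.

Lemma ival_cut lambda I x : 0 < lambda -> 0 < I.2 ->
  ival I x <-> ival (cut_left lambda I) x \/ ival (cut_right lambda I) x.
Proof.
move=> l0 I0; rewrite !ivalE /=.
have l1 : 1 + lambda != 0 by lra.
have -> : I.1 + I.2 / (1 + lambda) + lambda * (I.2 / (1 + lambda)) = I.1 + I.2.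
  by field.
have : 0 < I.2 / (1 + lambda) by rewrite divr_gt0// addr_gt0.
have : 0 < lambda * (I.2 / (1 + lambda))
  by rewrite mulr_gt0// divr_gt0// addr_gt0.
have : lambda * (I.2 / (1 + lambda)) + I.2 / (1 + lambda) = I.2 by field.
move: (I.2 / _) => u; move: (lambda * u) => v e v0 u0.
by lra.
Qed.

(** Both intervals are cut in the same proportion, so the affine bijection carries cut point to cut
    point. With the analogue for right parts, this makes the maps of successive columns
    consistent. *)
Lemma affine_cut_left lambda I J x : 0 < lambda -> 0 < I.2 ->
  affine_ival (cut_left lambda I) (cut_left lambda J) x = affine_ival I J x.
Proof.
move=> l0 /gt_eqF I0; rewrite /affine_ival /=.
by field; rewrite I0 /=; lra.
Qed.

Lemma affine_cut_right lambda I J x : 0 < lambda -> 0 < I.2 ->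
  affine_ival (cut_right lambda I) (cut_right lambda J) x = affine_ival I J x.
Proof.
move=> l0 /gt_eqF I0; rewrite /affine_ival /=.
by field; rewrite I0 (gt_eqF l0) /=; lra.
Qed.

Lemma measurable_ival I : measurable (ival I : set (measurableTypeR R)).
Proof. exact: measurable_itv. Qed.

End intervals.

(** * Lebesgue measure under affine maps *)

Section lebesgue_affine.
Context {R : realType}.
Local Notation mu := (@lebesgue_measure R).
Local Open Scope ereal_scope.

Lemma measurable_affine (a b : R) :
  measurable_fun [set: R] (fun x : R => a * x + b)%R.
Proof.
by apply: measurable_funD; [exact: mulrl_measurable|exact: measurable_cst].
Qed.

Lemma lebesgue_measure_affine (a b : R) (A : set R) : (0 < a)%R ->
  measurable A -> mu ((fun x => a * x + b)%R @^-1` A) = (a^-1)%:E * mu A.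
Proof.
move=> a0 mA.
pose f : measurableTypeR R -> measurableTypeR R := fun x => (a * x + b)%R.
have mf : measurable_fun setT f by exact: measurable_affine.
unshelve epose (m := pushforward mu f
  : {measure set (measurableTypeR R) -> \bar R}).
  exact: mf.
(* By uniqueness of Lebesgue measure it suffices that [a] times the pushforward gives each interval
   ]c, d] its length. *)
have -> : mu A = mscale (NngNum (ltW a0)) m A.
  apply: lebesgue_measure_unique => //= _ /ocitvP[->|[[c d] /= cd ->]].
    by rewrite !measure0.
  rewrite /mscale /= /pushforward.
  have -> : f @^-1` `]c, d] = `]((c - b) / a)%R, ((d - b) / a)%R]%classic.
    apply/seteqP; split => x; rewrite /f /= !in_itv /=;
    by rewrite ltr_pdivrMr// ler_pdivlMr// ltrBlDr lerBrDr (mulrC x).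
  rewrite !lebesgue_measure_itv /= !lte_fin ltr_pM2r ?invr_gt0// ltrD2r cd.
  by rewrite -EFinD -EFinM; congr _%:E; field; rewrite gt_eqF.
by rewrite /mscale /= muleA -EFinM mulVf ?gt_eqF// mul1e.
Qed.

Lemma negligible_affine (a b : R) (N : set R) : (0 < a)%R ->
  mu.-negligible N -> mu.-negligible ((fun x => a * x + b)%R @^-1` N).
Proof.
move=> a0 [M [mM M0 NM]]; exists ((fun x => a * x + b)%R @^-1` M); split.
- by rewrite -[_ @^-1` _]setTI; exact: measurable_affine.
- by rewrite lebesgue_measure_affine// M0 mule0.
- by move=> x /NM.
Qed.

Lemma lebesgue_measure_ival (I : R * R) : (0 < I.2)%R -> mu (ival I) = I.2%:E.
Proof.
move=> I0; rewrite /ival lebesgue_measure_itv /= lte_fin ltrDl I0.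
by rewrite -EFinD addrC addKr.
Qed.

(** Union bound: otherwise [I] would be covered by a null set, its part outside [A] and the pullback
    of the part of [J] outside [B]. The affine map preserves proportions, so these fill less than d
    + e <= 1 of [I]. *)
Lemma affine_ival_meet (I J : R * R) (A B N : set R) (d e : R) :
  (0 < I.2)%R -> (0 < J.2)%R -> measurable A -> measurable B ->
  mu.-negligible N ->
  mu (ival I `\` A) < (d * I.2)%:E -> mu (ival J `\` B) < (e * J.2)%:E ->
  (d + e <= 1)%R ->
  exists x, [/\ ival I x, ~ N x, A x & B (affine_ival I J x)].
Proof.
move=> I0 J0 mA mB [M [mM M0 NM]] IA JB de; apply: contrapT => nex.
pose f := (fun x => J.2 / I.2 * x + (J.1 - J.2 / I.2 * I.1))%R.
have s0 : (0 < J.2 / I.2)%R by rewrite divr_gt0.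
have mJB : measurable (ival J `\` B) by apply: measurableD => //;
  exact: measurable_ival.
have mIA : measurable (ival I `\` A) by apply: measurableD => //;
  exact: measurable_ival.
have mfJB : measurable (f @^-1` (ival J `\` B)).
  by rewrite -[_ @^-1` _]setTI; exact: measurable_affine.
have sub : ival I `<=` M `|` (ival I `\` A) `|` f @^-1` (ival J `\` B).
  move=> x xI; apply: contrapT => /not_orP[/not_orP[xM xA] xB].
  apply: nex; exists x; split => //; first by move/NM.
    by apply: contrapT => nA; apply: xA.
  apply: contrapT => nB; apply: xB; rewrite /f /= -affine_ival_linear.
  by split => //; apply/affine_ivalP.
have : mu (ival I) <= mu M + mu (ival I `\` A) + mu (f @^-1` (ival J `\` B)).
  apply: (le_trans (le_measure mu _ _ sub)); rewrite ?inE //.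
  - exact: measurable_ival.
  - by apply: measurableU => //; exact: measurableU.
  apply: le_trans (measureU2 _ _ _) _ => //; first exact: measurableU.
  by apply: leeD => //; exact: measureU2.
rewrite lebesgue_measure_ival// M0 add0e lebesgue_measure_affine//.
apply/negP; rewrite -ltNge.
apply: (@lt_le_trans _ _ ((d * I.2)%:E + (e * I.2)%:E)).
  have -> : (e * I.2)%:E = ((J.2 / I.2)^-1)%:E * (e * J.2)%:E.
    by rewrite -EFinM; congr _%:E; field; rewrite !gt_eqF.
  apply: lteD => //; rewrite lte_pmul2l// lte_fin invr_gt0//.
by rewrite -EFinD lee_fin -mulrDl ger_pMl.
Qed.

End lebesgue_affine.

(** * Levels of the columns and the transformation they define *)

Section levels.
Context {R : realType} (lambda : R) (sp : nat -> nat -> R * R).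
Hypotheses (lambda_gt0 : 0 < lambda) (spP : HK_spacers lambda sp).
Local Notation h := HK_height.
Local Notation C := (HK_level lambda sp).
Local Notation X := (HK_space lambda sp).
Local Notation S := (HK_map lambda sp).
Local Notation mu := (@lebesgue_measure R).

Lemma HK_level_left k i : (i < h k)%N -> C k.+1 i = cut_left lambda (C k i).
Proof. by move=> ih /=; rewrite ih. Qed.

Lemma HK_level_right k i : (i < h k)%N ->
  C k.+1 (i + h k)%N = cut_right lambda (C k i).
Proof.
by move=> ih /=; rewrite ltnNge leq_addl /= addnK mul2n -addnn ltn_add2r ih.
Qed.

Lemma HK_level_gt0 k i : (i < h k)%N -> 0 < (C k i).2.
Proof.
have [sp0 _ _] := spP.
elim: k i => [|k IH] i ih; first by rewrite /= ltr01.
have [i1|i1] := ltnP i (h k).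
  by rewrite HK_level_left//; apply: cut_left_gt0 => //; exact: IH.
have [i2|i2] := ltnP i (2 * h k).
  have i3 : (i - h k < h k)%N by lia.
  by rewrite -(subnK i1) HK_level_right//; apply: cut_right_gt0 => //;
    exact: IH.
rewrite /= ltnNge i1 /= ltnNge i2 /=; apply: sp0.
by move: ih => /=; lia.
Qed.

Lemma HK_level_inj k i j x : (i < h k)%N -> (j < h k)%N ->
  ival (C k i) x -> ival (C k j) x -> i = j.
Proof.
have [_ tI _] := spP.
by move=> ih jh xi xj; apply: (tI k i j ih jh); exists x.
Qed.

Lemma HK_level_child k i x : (i < h k)%N -> ival (C k i) x ->
  exists j, [/\ (j < h k.+1)%N, ival (C k.+1 j) x &
    ival (C k.+1 j) `<=` ival (C k i)].
Proof.
move=> ih; have C0 := HK_level_gt0 _ _ ih.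
case/(ival_cut lambda) => // xi; [exists i|exists (i + h k)%N].
  rewrite HK_level_left//; split => //; first by move: ih => /=; lia.
  by move=> y yi; apply/(ival_cut lambda) => //; left.
rewrite HK_level_right//; split => //; first by move: ih => /=; lia.
by move=> y yi; apply/(ival_cut lambda) => //; right.
Qed.

Lemma HK_level_descendant k i m x : (k <= m)%N -> (i < h k)%N ->
  ival (C k i) x -> exists2 j, (j < h m)%N & ival (C m j) x.
Proof.
move=> /subnKC <-; elim: (m - k)%N => [|n IH] ih xi.
  by rewrite addn0; exists i.
have [j jh /(HK_level_child _ _ _ jh)[l [lh xl _]]] := IH ih xi.
by rewrite addnS; exists l.
Qed.

(** Consecutive levels have consecutive left parts and consecutive right parts in the next column,
    and the affine bijections restrict to these parts. *)
Lemma HK_step_descendant k i m x : (k <= m)%N -> (i.+1 < h k)%N ->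
  ival (C k i) x -> exists j, [/\ (j.+1 < h m)%N, ival (C m j) x &
    affine_ival (C m j) (C m j.+1) x = affine_ival (C k i) (C k i.+1) x].
Proof.
move=> /subnKC <- ih xi; elim: (m - k)%N => [|n [j [jh xj <-]]].
  by rewrite addn0; exists i.
rewrite addnS; move: (k + n)%N jh xj => {xi ih}l jh xj.
have jh' : (j < h l)%N by exact: ltnW.
have C0 := HK_level_gt0 _ _ jh'.
case/(ival_cut lambda): (xj) => // xi; [exists j|exists (j + h l)%N].
  by rewrite !HK_level_left// affine_cut_left//; split => //; move: jh => /=;
    lia.
rewrite -addSn !HK_level_right// affine_cut_right//; split => //.
by move: jh => /=; lia.
Qed.

(** Two candidate values at [x], from columns k and m, are compared in column [maxn k m], where
    disjointness leaves only one level containing [x]. *)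
Lemma HK_mapE k i x : (i.+1 < h k)%N -> ival (C k i) x ->
  S x = affine_ival (C k i) (C k i.+1) x.
Proof.
move=> ih xi; rewrite /HK_map; apply: xget_unique; first by exists k, i.
move=> _ [m [j [jh xj ->]]].
have [a [ah xa <-]] := HK_step_descendant _ _ _ _ (leq_maxl k m) ih xi.
have [b [bh xb <-]] := HK_step_descendant _ _ _ _ (leq_maxr k m) jh xj.
by have -> // := HK_level_inj _ _ _ _ (ltnW ah) (ltnW bh) xa xb.
Qed.

Lemma HK_level_sub k i : (i < h k)%N -> ival (C k i) `<=` X.
Proof. by move=> ih x xi; exists k => //; exists i. Qed.

Lemma measurable_HK_space : measurable (X : set (measurableTypeR R)).
Proof.
apply: bigcupT_measurable => k; apply: bigcup_measurable => i _.
exact: measurable_ival.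
Qed.

Lemma HK_space_descendant x : X x -> exists k0, forall k, (k0 <= k)%N ->
  exists2 i, (i < h k)%N & ival (C k i) x.
Proof. by case=> k _ [i ih xi]; exists k => m km;
  exact: HK_level_descendant xi. Qed.

(** * Null sets and Lebesgue density along the levels *)

Lemma HK_space_negligible (A : set R) : A `<=` X ->
  (forall k i, (i < h k)%N -> mu.-negligible (A `&` ival (C k i))) ->
  mu.-negligible A.
Proof.
move=> AX nA.
have : mu.-negligible (\bigcup_k \bigcup_(i in `I_(h k)) (A `&` ival (C k i))).
  apply: negligible_bigcup => k; rewrite bigcup_mkord.
  by elim/big_ind: _ => [|? ? a b|i _];
    [exact: negligible_set0|exact: negligibleU a b|exact: nA].
apply: negligibleS => x Ax; have [k _ [i ih xi]] := AX x Ax.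
by exists k => //; exists i.
Qed.

Lemma measure_gt0_negligible (A : set (measurableTypeR R)) : measurable A ->
  ~ mu.-negligible A -> (0 < mu A)%E.
Proof.
by move=> mA nA; rewrite lt0e measure_ge0 andbT; apply/eqP => A0;
  exact/nA/negligibleP.
Qed.

(* The levels contained in an open U exhaust U `&` X as k grows, so that for U a
   tight neighbourhood of A they cannot all have a large part outside A. *)
Lemma HK_density_finite (A : set (measurableTypeR R)) (d : R) :
  measurable A -> A `<=` X -> (0 < mu A < +oo)%E -> 0 < d ->
  exists k0, forall k, (k0 <= k)%N -> exists i, (i < h k)%N /\
    (mu (ival (C k i) `\` A) < (d * (C k i).2)%:E)%E.
Proof.
move=> mA AX /andP[A0 Aoo] d0.
have [a Aa] : exists a, mu A = a%:E.
  by exists (fine (mu A)); rewrite fineK// ge0_fin_numE// ltW.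
have a0 : 0 < a by rewrite -lte_fin -Aa.
(* This is the allowed excess of [U] over [A]: levels filling more than a / 2, each with proportion
   at least d outside [A], would exceed it. *)
have da : 0 < d * (a / 2) by rewrite mulr_gt0// divr_gt0.
have [U [oU AU UA]] := @lebesgue_regularity_outer R A _ mA Aoo da.
pose P k := [set i | (i < h k)%N /\ ival (C k i) `<=` U].
pose V k : set (measurableTypeR R) := \bigcup_(i in P k) ival (C k i).
have mV k : measurable (V k) by apply: bigcup_measurable => i _;
  exact: measurable_ival.
have ndV : nondecreasing_seq V.
  apply/nondecreasing_seqP => k; apply/subsetPset => x [i [ih iU] xi].
  have [j [jh xj ji]] := HK_level_child _ _ _ ih xi.
  by exists j => //; split => //; exact: subset_trans iU.
have AV : A `<=` \bigcup_k V k.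
  move=> x Ax; have [k0 xk0] := HK_space_descendant _ (AX _ Ax).
  have /nbhs_ballP[r /= r0 xrU] : nbhs x U by apply: open_nbhs_nbhs;
    split => //; exact: AU.
  have [_ _ /cvgrPdist_lt /(_ _ r0)[k1 _ k1r]] := spP.
  (* Past [k0] some level contains [x]; past [k1] every level is shorter than the radius [r] of a
     ball around [x] inside [U]. *)
  pose k := maxn k0 k1; have [i ih xi] := xk0 k (leq_maxl _ _).
  exists k => //; exists i => //; split => // y yi; apply: xrU.
  have : (C k i).2 < r.
    have := k1r k (leq_maxr _ _); rewrite /= sub0r normrN.
    apply: le_lt_trans; apply: le_trans (ler_norm _).
    exact: (@le_bigmax _ _ _ 0 (fun i : 'I_(h k) => (C k i).2) (Ordinal ih)).
  move: xi yi; rewrite !ivalE -ball_normE /= ltr_norml =>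
    /andP[? ?] /andP[? ?] ?.
  by apply/andP; split; lra.
(* Continuity from below: the [V k] increase to a set containing [A], of measure at least a > a /
   2. *)
have [k0 Vk0] : exists k0, ((a / 2)%:E < mu (V k0))%E.
  apply: contrapT => nV.
  have mUV : measurable (\bigcup_k V k) by exact: bigcupT_measurable.
  have cV := nondecreasing_cvg_mu (mu := mu) mV mUV ndV.
  have : (mu (\bigcup_k V k) <= (a / 2)%:E)%E.
    rewrite -(cvg_lim _ cV)//; apply: lime_le; first by apply/cvg_ex; eexists;
      exact: cV.
    by apply: nearW => k /=; rewrite leNgt; apply/negP => Vk; apply: nV;
      exists k.
  apply/negP; rewrite -ltNge; apply: (@lt_le_trans _ _ (mu A)).
    by rewrite Aa lte_fin; lra.
  by apply: le_measure => //; rewrite inE.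
exists k0 => k kk0; apply: contrapT => nk.
have {Vk0 kk0}Vk : ((a / 2)%:E < mu (V k))%E.
  apply: lt_le_trans Vk0 _; apply: le_measure; rewrite ?inE//.
  by apply/subsetPset; exact: ndV.
have fP : finite_set (P k)
  by apply: (sub_finite_set _ (finite_II (h k))) => i [].
have tP : trivIset (P k) (fun i => ival (C k i)).
  by have [_ tI _] := spP; apply: sub_trivIset (tI k) => i [].
(* This bound is contradicted by summing the parts outside [A] over the levels in [P k]: by [nk]
   each is at least d times its level. *)
have : (mu (V k `\` A) <= mu (U `\` A))%E.
  apply: le_measure; rewrite ?inE.
  - exact: measurableD.
  - by apply: measurableD => //; exact: open_measurable.
  - by move=> x [[i [ih iU] xi] nAx]; split => //; exact: iU.
apply/negP; rewrite -ltNge; apply: (lt_trans UA).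
rewrite EFinM; apply: (@lt_le_trans _ _ (d%:E * mu (V k))%E).
  by rewrite lte_pmul2l.
have -> : V k `\` A = \bigcup_(i in P k) (ival (C k i) `\` A).
  by rewrite /V setDE setI_bigcupl.
rewrite !measure_fin_bigcup//; last 3 first.
- move=> i j Pi Pj [x [[xi _] [xj _]]]; apply: tP => //; by exists x.
- by move=> i _; apply: measurableD => //; exact: measurable_ival.
- by move=> i _; exact: measurable_ival.
rewrite ge0_mule_fsumr; last by move=> i; exact: measure_ge0.
apply: lee_fsum => // i [ih _].
change (d%:E * mu (ival (C k i)) <= mu (ival (C k i) `\` A))%E.
rewrite lebesgue_measure_ival; last exact: HK_level_gt0.
by rewrite -EFinM leNgt; apply/negP => ik; apply: nk; exists i.
Qed.

(** The measure of [A] may be infinite, so [A] is first cut down to a level that it meets in a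
    non-null set; a level mostly filled by this smaller set is mostly filled by [A]. *)
Lemma HK_density (A : set (measurableTypeR R)) (d : R) :
  measurable A -> A `<=` X -> ~ mu.-negligible A -> 0 < d ->
  exists k0, forall k, (k0 <= k)%N -> exists i, (i < h k)%N /\
    (mu (ival (C k i) `\` A) < (d * (C k i).2)%:E)%E.
Proof.
move=> mA AX nA d0.
have [l [j [jh nAj]]]
  : exists l j, (j < h l)%N /\ ~ mu.-negligible (A `&` ival (C l j)).
  apply: contrapT => nlj; apply: nA; apply: HK_space_negligible => // l j jh.
  by apply: contrapT => nAj; apply: nlj; exists l, j.
have mj := measurable_ival (C l j).
have mAj : measurable (A `&` ival (C l j) : set (measurableTypeR R))
  by exact: measurableI.
have [||k0 k0P] := @HK_density_finite (A `&` ival (C l j)) d mAj _ _ d0.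
- by move=> x [/AX].
- rewrite measure_gt0_negligible//=.
  apply: (@le_lt_trans _ _ (mu (ival (C l j)))); first by apply: le_measure;
    rewrite ?inE.
  by rewrite lebesgue_measure_ival ?ltry//; exact: HK_level_gt0.
exists k0 => k /k0P[i [ih ik]]; exists i; split => //; apply: le_lt_trans ik.
have mi := measurable_ival (C k i).
apply: le_measure; rewrite ?inE; [exact: measurableD|exact: measurableD|].
by move=> x [xi nAx]; split => // -[].
Qed.

(** * Iterates along a column, ergodicity and return times *)

Lemma HK_equivariant_iter {Y : Type} (T : Y -> Y) (phi : R -> Y) :
  {ae mu, forall x, X x -> T (phi x) = phi (S x)} ->
  forall k i n, (i + n < h k)%N ->
  mu.-negligible [set x | ival (C k i) x /\
    phi (affine_ival (C k i) (C k (i + n)%N) x) <> iter n T (phi x)].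
Proof.
move=> phiT k i; elim=> [|n IH] inh.
  apply: negligibleS (negligible_set0 mu) => x [xi]; rewrite addn0 in inh *.
  by rewrite affine_ival_id//; exact: HK_level_gt0.
have inh' : (i + n < h k)%N by apply: leq_trans inh; rewrite addnS.
have ih : (i < h k)%N by apply: leq_ltn_trans inh'; exact: leq_addr.
have I0 := HK_level_gt0 _ _ ih; have J0 := HK_level_gt0 _ _ inh'.
(* The new exceptional points are those sent by the affine map to level i + n at a point where
   equivariance fails: the pullback of a null set. *)
have := negligible_affine _ ((C k (i + n)%N).1 -
  (C k (i + n)%N).2 / (C k i).2 * (C k i).1) _ (divr_gt0 J0 I0) phiT.
move/(negligibleU (IH inh')); apply: negligibleS => x [xi xn].
rewrite addnS in inh xn.
apply: contrapT => /not_orP[/not_andP[//|/contrapT xIH]].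
rewrite /preimage /= -affine_ival_linear => /contrapT.
have yi : ival (C k (i + n)%N) (affine_ival (C k i) (C k (i + n)%N) x).
  exact/affine_ivalP.
move=> /(_ (HK_level_sub _ _ inh' _ yi)).
rewrite (HK_mapE _ _ _ inh yi) affine_ival_comp// xIH => xn'.
by apply: xn; rewrite -xn'.
Qed.

Lemma HK_ergodic (E : set R) : measurable (X `&` E : set (measurableTypeR R)) ->
  {ae mu, forall x, X x -> E x = E (S x)} ->
  mu.-negligible (X `&` E) \/ mu.-negligible (X `\` E).
Proof.
move=> mE invE.
have mXE : measurable (X `\` E : set (measurableTypeR R)).
  have -> : X `\` E = X `\` (X `&` E) by rewrite setDIr setDv set0U.
  by apply: measurableD => //; exact: measurable_HK_space.
apply: contrapT => /not_orP[nE nXE].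
have half_gt0 : 0 < 2^-1 :> R by rewrite invr_gt0.
have [k0 k0P] := HK_density _ _ mE (@subIsetl _ _ _) nE half_gt0.
have [k1 k1P] := HK_density _ _ mXE (@subDsetl _ _ _) nXE half_gt0.
have [i [ih iE]] := k0P _ (leq_maxl k0 k1).
have [j [jh jE]] := k1P _ (leq_maxr k0 k1).
move: (maxn k0 k1) => k in i ih iE j jh jE.
(* A set is a map to [Prop], so invariance of [E] is equivariance with [T] the identity of
   [Prop]. *)
have neg l n : (l + n < h k)%N -> mu.-negligible [set x | ival (C k l) x /\
    E (affine_ival (C k l) (C k (l + n)%N) x) <> E x].
  move=> lnh; have := HK_equivariant_iter id E invE _ _ _ lnh.
  by apply: negligibleS => x [? ?]; split => //; rewrite iter_fix.
have halves : 2^-1 + 2^-1 <= 1 :> R by lra.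
(* [neg] only goes up the column, so the affine map has to start from the lower of the two
   levels. *)
have [ij|/ltnW ji] := leqP i j; [move: (ij)|move: (ji)] => /subnKC eij.
- have Nij : mu.-negligible _ := neg i (j - i)%N ltac:(by rewrite eij).
  have [] := affine_ival_meet (C k i) (C k j) _ _ _ _ _ (HK_level_gt0 _ _ ih)
    (HK_level_gt0 _ _ jh) mE mXE Nij iE jE halves.
  move=> x [xi nN [_ xE] [_ nE']]; apply: nN; split => //; rewrite eij => EE.
  by apply: nE'; rewrite EE.
- have Nji : mu.-negligible _ := neg j (i - j)%N ltac:(by rewrite eij).
  have [] := affine_ival_meet (C k j) (C k i) _ _ _ _ _ (HK_level_gt0 _ _ jh)
    (HK_level_gt0 _ _ ih) mXE mE Nji jE iE halves.
  move=> x [xj nN [_ xE] [_ nE']]; apply: nN; split => //; rewrite eij => EE.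
  by apply: xE; rewrite -EE.
Qed.

(* S^(h k) maps the left part of C_k(i) onto its right part. *)
Lemma HK_return {Y : Type} (T : Y -> Y) (phi : R -> Y) (W : set Y) k i d :
  {ae mu, forall x, X x -> T (phi x) = phi (S x)} ->
  measurable (X `&` phi @^-1` W : set (measurableTypeR R)) ->
  (i < h k)%N -> d * ((1 + lambda) ^+ 2 / lambda) <= 1 ->
  (mu (ival (C k i) `\` (X `&` phi @^-1` W)) < (d * (C k i).2)%:E)%E ->
  exists2 y, W y & W (iter (h k) T y).
Proof.
move=> phiT mW ih d1 iW; pose A := X `&` phi @^-1` W.
have C0 := HK_level_gt0 _ _ ih.
have ih' : (i + h k < h k.+1)%N by rewrite /=; lia.
have ih'' : (i < h k.+1)%N by apply: leq_ltn_trans ih'; exact: leq_addr.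
have mu_sub J : ival J `<=` ival (C k i) ->
    (mu (ival J `\` A) < (d * (C k i).2)%:E)%E.
  move=> JI; apply: le_lt_trans iW; have mJ := measurable_ival J.
  have mi := measurable_ival (C k i).
  apply: le_measure; rewrite ?inE; [exact: measurableD|exact: measurableD|].
  by apply: setSD.
have l1 : 1 + lambda != 0 by rewrite gt_eqF// addr_gt0.
(* The left and right parts take up 1 / (1 + lambda) and lambda / (1 + lambda) of the level, so a
   proportion d of the level becomes these proportions of the parts; their sum is d (1 + lambda)^2 /
   lambda. *)
have := affine_ival_meet (cut_left lambda (C k i)) (cut_right lambda (C k i))
  A A _ (d * (1 + lambda)) (d * (1 + lambda) / lambda)
  (cut_left_gt0 _ _ lambda_gt0 C0) (cut_right_gt0 _ _ lambda_gt0 C0) mW mW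
  (HK_equivariant_iter T phi phiT _ _ _ ih').
rewrite -HK_level_left// -HK_level_right//.
case.
- have -> : d * (1 + lambda) * (C k.+1 i).2 = d * (C k i).2.
    by rewrite HK_level_left//=; field.
  apply: mu_sub; rewrite HK_level_left// => x xl.
  by apply/(ival_cut lambda) => //; left.
- have -> : d * (1 + lambda) / lambda * (C k.+1 (i + h k)%N).2 = d * (C k i).2.
    by rewrite HK_level_right//=; field; rewrite l1 gt_eqF.
  apply: mu_sub; rewrite HK_level_right// => x xl.
  by apply/(ival_cut lambda) => //; right.
- apply: le_trans d1; rewrite le_eqVlt; apply/orP; left; apply/eqP.
  by field; rewrite gt_eqF.
move=> x [xi nN [_ Wx] [_ Wx']]; exists (phi x) => //.
suff <- : phi (affine_ival (C k.+1 i) (C k.+1 (i + h k)%N) x) = iter (h k) T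
  (phi x) by [].
by apply: contrapT => neq; apply: nN.
Qed.

Lemma HK_returns {Y : Type} (T : Y -> Y) (phi : R -> Y) (W : set Y) :
  {ae mu, forall x, X x -> T (phi x) = phi (S x)} ->
  measurable (X `&` phi @^-1` W : set (measurableTypeR R)) ->
  ~ mu.-negligible (X `&` phi @^-1` W) ->
  exists n, (exists2 y, W y & W (iter n T y)) /\
            (exists2 y, W y & W (iter (4 * n + 1) T y)).
Proof.
(* [HK_return] tolerates lambda / (1 + lambda)^2; the extra factor 1 + lambda pays for passing to
   the left part of the level. *)
move=> phiT mW nW; pose d := lambda / (1 + lambda) ^+ 3.
have l1 : 0 < 1 + lambda by rewrite addr_gt0.
have d0 : 0 < d by rewrite divr_gt0// exprn_gt0.
have [k0 k0P] := HK_density _ _ mW (@subIsetl _ _ _) nW d0.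
have {k0P}[i [ih iW]] := k0P _ (leqnn k0); exists (h k0); split.
  apply: (HK_return T phi W k0 i d) => //.
  rewrite /d (_ : _ * _ = (1 + lambda)^-1); last first.
    by field; rewrite !gt_eqF.
  by rewrite invf_le1// lerDl ltW.
(* Level i of the next column is the left part of level i, and the height there is 4 * h k0 + 1. *)
apply: (HK_return T phi W k0.+1 i (d * (1 + lambda))) => //.
- by rewrite /=; lia.
- by rewrite /d le_eqVlt; apply/orP; left; apply/eqP; field; rewrite !gt_eqF.
have C0 := HK_level_gt0 _ _ ih.
rewrite HK_level_left//= (_ : _ * _ * _ = d * (C k0 i).2); last first.
  by field; rewrite gt_eqF.
apply: le_lt_trans iW; have mi := measurable_ival (C k0 i).
have mi' := measurable_ival (cut_left lambda (C k0 i)).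
apply: le_measure; rewrite ?inE; [exact: measurableD|exact: measurableD|].
by apply: setSD => x xl; apply/(ival_cut lambda) => //; left.
Qed.

End levels.

(** * Displacements of isometries *)

Section isometries.
Context {R : realType} {Y : metricType R} (T : Y -> Y).
Hypothesis Tiso : metric_isometry T.

Lemma iter_isometry n (x y : Y) : mdist (iter n T x) (iter n T y) = mdist x y.
Proof. by elim: n => //= n <-; exact: Tiso. Qed.

(** The points y, T^n y, T^(2n) y, ... are equally spaced because T^n is an isometry; the triangle
    inequality then applies. *)
Lemma mdist_iterM n m (y : Y) :
  mdist (iter (m * n) T y) y <= m%:R * mdist (iter n T y) y.
Proof.
elim: m => [|m IH]; first by rewrite mul0n mul0r /= mdistxx.
apply: le_trans (metric_triangle _ (iter n T y) _) _.
by rewrite mulSn iterD iter_isometry -natr1 mulrDl mul1r lerD2r.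
Qed.

(** T^n moves [y0] by less than 2e, hence [y1] by less than 2e + 2 * 2e = 6e, and T^(4n) moves [y1]
    by less than 24e. As T^(4n+1) moves [y1] by less than 2e, [T] moves it by less than 26e. *)
Lemma mdist_displacement n e (c y0 y1 : Y) :
  mdist c y0 < e -> mdist c (iter n T y0) < e ->
  mdist c y1 < e -> mdist c (iter (4 * n + 1) T y1) < e ->
  mdist (T y1) y1 < 26 * e.
Proof.
move=> a0 b0 a1 b1.
have d0 := metric_triangle (iter n T y0) c y0.
have d01 := metric_triangle y0 c y1.
have d1 := metric_triangle (iter (4 * n + 1) T y1) c y1.
have t0 := metric_triangle (iter n T y1) (iter n T y0) y1.
have t1 := metric_triangle (iter n T y0) y0 y1.
have t2 := metric_triangle (T y1) (iter (4 * n + 1) T y1) y1.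
have t3 := mdist_iterM n 4 y1.
have s : mdist (T y1) (iter (4 * n + 1) T y1) = mdist (iter (4 * n) T y1) y1.
  by rewrite addn1 iterS Tiso metric_sym.
rewrite iter_isometry (metric_sym y1 y0) in t0.
rewrite (metric_sym _ c) in d0; rewrite (metric_sym _ c) in d01.
rewrite (metric_sym _ c) in d1; rewrite s in t2.
lra.
Qed.

(** The displacement is 2-Lipschitz, whence a radius equal to half the excess over [r]. *)
Lemma open_displacement (r : R) : open [set y | r < mdist (T y) y].
Proof.
rewrite openE => y /= ry; apply/metricType_numDomainType.nbhs_mdistP.
exists ((mdist (T y) y - r) / 2) => /=; first by rewrite divr_gt0// subr_gt0.
move=> z /= yz.
have t1 := metric_triangle (T y) (T z) y.
have t2 := metric_triangle (T z) z y.
rewrite Tiso in t1; rewrite (metric_sym z y) in t2.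
lra.
Qed.

End isometries.

(** * Balls in a separable metric space *)

Lemma open_mdist_ball {R : realType} {Y : metricType R} (c : Y) (e : R) :
  open (ball c e).
Proof.
rewrite openE ballEmdist => y /= => cy;
  apply/metricType_numDomainType.nbhs_mdistP.
exists (e - mdist c y) => /=; first by rewrite subr_gt0.
by move=> z /= yz; have := metric_triangle c y z; lra.
Qed.

Lemma negligible_ball_cover {R : realType} {Y : metricType R} (phi : R -> Y)
    (A : set R) (e : R) : separable_space Y -> 0 < e ->
  (forall y, (@lebesgue_measure R).-negligible (A `&` phi @^-1` ball y e)) ->
  (@lebesgue_measure R).-negligible A.
Proof.
move=> [D [/countable_injP[f finj] dD]] e0 nA.
(* The balls centred in the countable dense [D] cover [Y]; they are indexed by the codes [f y], and
   a number coding no point of [D] gives the empty set. *)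
pose F n := [set x | exists y, [/\ D y, f y = n & (A `&` phi @^-1` ball y e)
  x]].
have : (@lebesgue_measure R).-negligible (\bigcup_n F n).
  apply: negligible_bigcup => n.
  have [[y [Dy fy]]|nD] := pselect (exists y, D y /\ f y = n).
    apply: negligibleS (nA y) => x [z [Dz fz]].
    by have -> : z = y by apply: finj; rewrite ?inE// fy fz.
  apply: negligibleS (negligible_set0 _) => x [y [Dy fy _]].
  by apply: nD; exists y.
apply: negligibleS => x Ax.
have [|y [xy Dy]] := dD (ball (phi x) e)° _ (open_interior _).
  by exists (phi x); apply: nbhsx_ballx.
exists (f y) => //; exists y; split => //; split => //=.
by apply: ball_sym; exact: interior_subset.
Qed.

(** * Equivariant maps are invariant, and invariant maps are constant *)

Section equivariant_maps.
Context {R : realType} (lambda : R) (sp : nat -> nat -> R * R).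
Hypotheses (lambda_gt0 : 0 < lambda) (spP : HK_spacers lambda sp).
Context {Y : metricType R} (T : Y -> Y) (phi : R -> Y).
Hypotheses (Ysep : separable_space Y) (phiB
  : borel_on (HK_space lambda sp) phi).
Local Notation X := (HK_space lambda sp).
Local Notation S := (HK_map lambda sp).
Local Notation mu := (@lebesgue_measure R).

Lemma measurable_preimage_open (W : set Y) : open W ->
  measurable (X `&` phi @^-1` W : set (measurableTypeR R)).
Proof. by move=> oW; apply: phiB; exact: sub_gen_smallest. Qed.

Lemma HK_equivariant_fixed : metric_isometry T ->
  {ae mu, forall x, X x -> T (phi x) = phi (S x)} ->
  {ae mu, forall x, X x -> phi x = phi (S x)}.
Proof.
move=> Tiso phiT.
pose V n := [set y : Y | n.+1%:R^-1 < mdist (T y) y].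
have nV n : mu.-negligible (X `&` phi @^-1` V n).
  (* Chosen so that the bound 26e of [mdist_displacement] is the threshold defining [V n]. *)
  pose e : R := n.+1%:R^-1 / 26.
  have e0 : 0 < e by rewrite divr_gt0// invr_gt0 ltr0n.
  apply: (negligible_ball_cover phi _ e) => // c.
  apply: contrapT; rewrite -setIA -preimage_setI => nW.
  have mW : measurable (X `&` phi @^-1` (V n `&` (ball c e))
    : set (measurableTypeR R)).
    apply: measurable_preimage_open; apply: openI;
      first exact: open_displacement.
    exact: open_mdist_ball.
  have [m [[y0 [_ +] [_ +]] [y1 [+ +] [_ +]]]] :=
    HK_returns _ _ lambda_gt0 spP T phi _ phiT mW nW.
  rewrite !ballEmdist /V /= => a0 b0 Vy1 a1 b1.
  have := mdist_displacement T Tiso _ _ _ _ _ a0 b0 a1 b1.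
  by rewrite /e mulrCA divff ?mulr1 ?ltNge ?(ltW Vy1).
have := negligible_bigcup nV; move/(negligibleU phiT).
apply: negligibleS => x xn; apply: contrapT => /not_orP[/contrapT xT xV].
apply: xn => Xx; rewrite -xT//; apply: contrapT => /eqP.
rewrite eq_sym -mdist_gt0 => /ltr_add_invr[n xn].
by apply: xV; exists n => //; split => //; rewrite /V /= -[ltLHS]add0r.
Qed.

Lemma HK_invariant_constant :
  {ae mu, forall x, X x -> phi x = phi (S x)} ->
  exists y, {ae mu, forall x, X x -> phi x = y}.
Proof.
move=> phiS.
have nX : ~ mu.-negligible X.
  move=> /(negligibleP _ (measurable_HK_space lambda sp)) X0.
  have : (mu (ival (0%R, 1%R)) <= mu X)%E.
    apply: le_measure; rewrite ?inE.
    - exact: measurable_ival.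
    - exact: measurable_HK_space.
    (* The unit interval is the only level of C_0. *)
    - by move=> x x01; exists 0%N => //; exists 0%N.
  rewrite [mu X]X0 lebesgue_measure_ival ?ltr01// lee_fin.
  by rewrite ler10.
(* By ergodicity each ball has null or conull preimage; if all those of this radius were null, [X]
   would be null. *)
have conull n : exists c, mu.-negligible (X `\` phi @^-1` ball c n.+1%:R^-1).
  apply: contrapT => nc; apply: nX.
  apply: (negligible_ball_cover phi _ n.+1%:R^-1) => // c.
  have [] := HK_ergodic _ _ lambda_gt0 spP (phi @^-1` ball c n.+1%:R^-1).
  - by apply: measurable_preimage_open; exact: open_mdist_ball.
  - by apply: negligibleS phiS => x xn xS; apply: xn => /xS;
    rewrite /preimage /= => ->.
  - by [].
  - by move=> nXc; case: nc; exists c.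
have [c cP] := choice conull.
have nc := negligible_bigcup cP.
(* Almost every point lies in all these conull preimages; the images of two such points are within 2
   / (n + 1) for every n, so any one of them gives the constant. *)
have [x0 Xx0 x0c] : exists2 x0, X x0 & forall n, ball (c n) n.+1%:R^-1 (phi x0).
  apply: contrapT => nx; apply: nX; apply: negligibleS nc => x Xx.
  apply: contrapT => xc; apply: nx; exists x => // n; apply: contrapT => xn.
  by apply: xc; exists n.
exists (phi x0); apply: negligibleS nc => x xn; apply: contrapT => xc.
apply: xn => Xx; apply: contrapT => /eqP; rewrite -mdist_gt0 => dx.
have dx2 : 0 < mdist (phi x) (phi x0) / 2 by rewrite divr_gt0.
have [n nd] := ltr_add_invr dx2.
have : ball (c n) n.+1%:R^-1 (phi x).
  by apply: contrapT => xcn; apply: xc; exists n.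
have := x0c n; rewrite !ballEmdist /= => d0 d1.
have := metric_triangle (phi x) (c n) (phi x0); rewrite (metric_sym _ (c n)).
by move: n.+1%:R^-1 nd d0 d1 => e; lra.
Qed.

End equivariant_maps.

Theorem theorem4p3 (R : realType) (lambda : R) (sp : nat -> nat -> R * R)
    (lambda_gt0 : 0 < lambda) (lambda_lt1 : lambda < 1)
    (spP : HK_spacers lambda sp)
    (Y : metricType R) (Ysep : separable_space Y)
    (T : Y -> Y) (Tiso : metric_isometry T)
    (phi : R -> Y) (phiB : borel_on (HK_space lambda sp) phi)
    (phi_eqv : {ae (@lebesgue_measure R), forall x,
       HK_space lambda sp x -> T (phi x) = phi (HK_map lambda sp x)}) :
  exists y : Y, {ae (@lebesgue_measure R), forall x,
    HK_space lambda sp x -> phi x = y}.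
Proof.
have := HK_equivariant_fixed _ _ lambda_gt0 spP T phi Ysep phiB Tiso phi_eqv.
exact: (HK_invariant_constant _ _ lambda_gt0 spP phi Ysep phiB).
Qed.
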